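(* Let $d,n$ be positive integers and, for integers $e\geq 0$, let $U_e(n)=\sum_{k=1}^n \frac{2^{2k}}{\binom{2k}{k}} k^e$. Then \[ (2d+3)U_d(n) = \frac{(n+1)2^{2n+1}n^d}{\binom{2n}{n}} - \sum_{j=1}^d (-1)^j c_{d,j} U_{d-j}(n), \] where $c_{d,j} = \binom{d+1}{j+1} + \binom{d}{j+1}$, and \[ U_0(n) = \frac{1}{3}\left( \frac{(n+1)2^{2n+1}}{\binom{2n}{n}}-2\right). \]
   Context: Binomial coefficients $\binom{a}{b}$ with integers $0\le a<b$ are $0$. *)

(* Defs.v *)
From mathcomp Require Import all_boot all_order all_algebra.
Set Implicit Arguments.
Unset Strict Implicit.
Unset Printing Implicit Defensive.
Import GRing.Theory.
Local Open Scope ring_scope.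

Definition U (e n : nat) : rat :=
  \sum_(1 <= k < n.+1) (2 ^+ (2 * k) / 'C(2 * k, k)%:R) * k%:R ^+ e.

Definition c (d j : nat) : nat := ('C(d.+1, j.+1) + 'C(d, j.+1))%N.

(* Main.v *)
Require Import Defs.
From mathcomp Require Import all_boot all_order all_algebra.
From mathcomp Require Import ring.
Import GRing.Theory.
Local Open Scope ring_scope.

(** With a(k) = 4^k / C(2k,k) and G(k) = 2 (k+1) a(k) k^d, the recurrence
    2k a(k-1) = (2k-1) a(k) gives
    G(k) - G(k-1) = a(k) (2 (k+1) k^d - (2k-1) (k-1)^d).
    Expanding (2k-1) (k-1)^d = k (k-1)^d + (k-1)^(d+1) by the binomial theorem
    produces the coefficients c(d,j), and summing over k telescopes. *)

Lemma central_binS (n : nat) :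
  (n.+1 * 'C(2 * n.+1, n.+1) = 2 * (2 * n).+1 * 'C(2 * n, n))%N.
Proof.
have -> : (2 * n.+1 = (2 * n).+2)%N by rewrite mulnS.
(* Both sides are compared through the intermediate coefficient ['C((2 * n).+1, n)], after
   multiplying by [n.+1]. *)
have h1 := mul_bin_diag (2 * n).+2 n; have h2 := mul_bin_down (2 * n).+1 n.
rewrite /= in h1 h2; apply/eqP; rewrite -(eqn_pmul2l (ltn0Sn n)) -h1.
have e : ((2 * n).+1 - n = n.+1)%N by rewrite mul2n -addnn subSn ?leq_addr // addnK.
rewrite e in h2; rewrite mulnCA -h2.
have -> : ((2 * n).+2 = 2 * n.+1)%N by rewrite mulnS.
by apply/eqP; ring.
Qed.

Lemma central_bin_ratioS (n : nat) :
  2 * n.+1%:R * (2 ^+ (2 * n) / 'C(2 * n, n)%:R)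
    = (2 * n).+1%:R * (2 ^+ (2 * n.+1) / 'C(2 * n.+1, n.+1)%:R) :> rat.
Proof.
have bin_neq0 m : 'C(2 * m, m)%:R != 0 :> rat.
  by rewrite Num.Theory.pnatr_eq0 -lt0n bin_gt0 mul2n -addnn leq_addr.
have h := congr1 (fun m => m%:R : rat) (central_binS n).
rewrite /= !natrM in h.
have e2 : 2 ^+ (2 * n.+1) = 4 * 2 ^+ (2 * n) :> rat by rewrite mulnS exprD -natrX.
have /= b0 := bin_neq0 n; have /= b1 := bin_neq0 n.+1.
rewrite e2; move: h b0 b1.
move: ('C(2 * n.+1, n.+1)%:R : rat) ('C(2 * n, n)%:R : rat) (2 ^+ _) => y x p h x0 y0.
apply: (mulIf y0); transitivity (2 * p / x * (n.+1%:R * y)); first by field.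
by rewrite h; field; rewrite x0 y0.
Qed.

(** The index is shifted by one, the extra sign becoming the minus in front, so that [j] matches the
    power [x ^+ (d - j)] that sums to [U (d - j)]. *)
Lemma binomial_tail (R : comNzRingType) (x : R) (d : nat) :
  (x - 1) ^+ d.+1 = x ^+ d.+1
    - \sum_(j < d.+1) (-1) ^+ j * 'C(d.+1, j.+1)%:R * x ^+ (d - j).
Proof.
rewrite exprBn big_ord_recl /= bin0 subn0 expr0 mul1r expr1n mulr1.
congr (_ + _); rewrite -sumrN; apply: eq_bigr => i _.
by rewrite /bump /= add1n subSS expr1n mulr1 exprS -mulr_natr; ring.
Qed.

Lemma mul_binomial_tail (R : comNzRingType) (x : R) (d : nat) :
  x * (x - 1) ^+ d = x ^+ d.+1
    - \sum_(j < d.+1) (-1) ^+ j * 'C(d, j.+1)%:R * x ^+ (d - j).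
Proof.
(* The term [j = d] vanishes since ['C(d, d.+1) = 0]; it is kept in the statement so that this sum
   and that of [binomial_tail] have the same range and add up termwise to [c d j]. *)
rewrite big_ord_recr /= bin_small // mulr0 mul0r addr0.
case: d => [|d]; first by rewrite big_ord0 subr0 expr0 mulr1.
rewrite binomial_tail mulrBr -exprS mulr_sumr; congr (_ - _).
apply: eq_bigr => i _; rewrite subSn; last by rewrite -ltnS.
by rewrite exprS; ring.
Qed.

Lemma telescoping_term (R : comNzRingType) (x : R) (d : nat) :
  2 * (x + 1) * x ^+ d - (2 * x - 1) * (x - 1) ^+ d =
    (2 * d + 3)%:R * x ^+ d
    + \sum_(1 <= j < d.+1) (-1) ^+ j * (c d j)%:R * x ^+ (d - j).
Proof.
transitivity (2 * x ^+ d + \sum_(0 <= j < d.+1) (-1) ^+ j * (c d j)%:R * x ^+ (d - j)).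
  rewrite [(2 * x - 1) * _](_ : _ = x * (x - 1) ^+ d + (x - 1) ^+ d.+1); last first.
    by rewrite exprS; ring.
  rewrite binomial_tail mul_binomial_tail big_mkord.
  under [in RHS]eq_bigr => j _ do rewrite /c natrD mulrDr mulrDl.
  by rewrite big_split /= exprS; ring.
(* The term [j = 0] has coefficient [c d 0 = 2d + 1]; with the leftover [2 * x ^+ d] it makes
   [2d + 3]. *)
rewrite big_ltn // expr0 mul1r subn0 /c !bin1 addrA; congr (_ + _).
ring.
Qed.

(** Allowing [d = 0] covers both claims at once: the boundary term [2 * 0 ^+ d] is G(0), which is 0
    for positive [d] and 2 for [d = 0]. *)
Lemma U_recurrence (d n : nat) :
  (2 * d + 3)%:R * U d n
    + \sum_(1 <= j < d.+1) (-1) ^+ j * (c d j)%:R * U (d - j) n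
  = 2 * n.+1%:R * (2 ^+ (2 * n) / 'C(2 * n, n)%:R) * n%:R ^+ d - 2 * 0 ^+ d.
Proof.
elim: n => [|n IHn].
  have U0 e : U e 0 = 0 by rewrite /U big_geq.
  rewrite U0 big1 => [|j _]; last by rewrite U0 mulr0.
  by rewrite mulr0 muln0 bin0 expr0 divr1 !mulr1 addr0 subrr.
have US e : U e n.+1 = U e n
    + 2 ^+ (2 * n.+1) / 'C(2 * n.+1, n.+1)%:R * n.+1%:R ^+ e.
  by rewrite /U big_nat_recr.
under eq_bigr => j _ do rewrite US mulrDr.
(* The ratio recurrence turns G(n) into a multiple of a(n+1), so that a(n+1) factors out and
   [telescoping_term] applies at [x = n.+1%:R]. *)
rewrite US big_split mulrDr addrACA IHn central_bin_ratioS.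
set a := 2 ^+ (2 * n.+1) / _.
under eq_bigr => j _ do rewrite mulrCA.
rewrite -mulr_sumr [_%:R * (a * _)]mulrCA -mulrDr -telescoping_term.
by rewrite -[(2 * n).+1%:R]natr1 natrM -[n.+2%:R]natr1 -[n.+1%:R]natr1 addrK; ring.
Qed.

Theorem theorem3p1 (d n : nat) (hd : (0 < d)%N) (hn : (0 < n)%N) :
  (2 * d + 3)%:R * U d n =
    (n.+1%:R * 2 ^+ (2 * n).+1 * n%:R ^+ d) / 'C(2 * n, n)%:R
    - \sum_(1 <= j < d.+1) (-1) ^+ j * (c d j)%:R * U (d - j) n
  /\
  U 0 n = 1 / 3 * (n.+1%:R * 2 ^+ (2 * n).+1 / 'C(2 * n, n)%:R - 2).
Proof.
split.
  apply/eqP; rewrite -subr_eq opprK; apply/eqP.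
  by rewrite U_recurrence expr0n eqn0Ngt hd mulr0 subr0 exprS; ring.
have := U_recurrence 0 n; rewrite big_geq // addr0 !expr0 !mulr1 exprS => h.
have three_neq0 : (3 : rat) != 0 by [].
by apply: (mulfI three_neq0); rewrite h !mulrA mulr1 divff // mul1r [2 * _]mulrC.
Qed.
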